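(* Let $\mathcal{D}$ be a dyadic grid on $\mathbb{R}$. For any $1/2<s<1$, the space $H^s_{\mathcal{D}}(\mathbb{R})$ is an algebra, that is, $f\in H^s_{\mathcal{D}}(\mathbb{R})$ implies $f^2\in H^s_{\mathcal{D}}(\mathbb{R})$.
   Context: A dyadic grid $\mathcal{D}$ on $\mathbb{R}$ is a collection of intervals such that: (D1) every $I\in\mathcal{D}$ has length $2^k$ for some $k\in\mathbb{Z}$; (D2) for any fixed $k_0\in\mathbb{Z}$, the intervals of $\mathcal{D}$ of length $2^{k_0}$ form a partition of $\mathbb{R}$; (D3) $I\cap J\in\{\varnothing,I,J\}$ for all $I,J\in\mathcal{D}$. $|\cdot|$ denotes Lebesgue measure. For $I\in\mathcal{D}$, $I_+$ and $I_-$ denote the right and left halves of $I$ (the two elements of $\mathcal{D}$ of length $|I|/2$ contained in $I$), and $h_I:=|I|^{-1/2}(\mathbf{1}_{I_+}-\mathbf{1}_{I_-})$ is the Haar function; $\{h_I\}_{I\in\mathcal{D}}$ is an orthonormal basis of $L^2(\mathbb{R})$. Functions are real-valued and $(f,g):=\int_{\mathbb{R}}fg\,dx$. The space $H^s_{\mathcal{D}}(\mathbb{R})$ consists of all $f\in L^2(\mathbb{R})$ with $\sum_{I\in\mathcal{D}}|I|^{-2s}|(f,h_I)|^2<\infty$. Being an algebra means being closed under pointwise multiplication, which for this vector space is equivalent to closedness under squaring. *)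

(* Defs.v *)
From HB Require Import structures.
From mathcomp Require Import all_boot all_order all_algebra.
From mathcomp Require Import all_classical all_reals all_analysis.

Set Implicit Arguments.
Unset Strict Implicit.
Unset Printing Implicit Defensive.

Import Order.TTheory GRing.Theory Num.Theory.
Import numFieldNormedType.Exports.

Local Open Scope classical_set_scope.
Local Open Scope ring_scope.

Section DyadicSobolev.
Context {R : realType}.
Implicit Types (D : set (set R)) (I J : set R) (f g : R -> R) (s : R).

Local Notation mu := (@lebesgue_measure R).

(* Intervals are arbitrary convex sets: whether endpoints belong to them is
   constrained only by the partition condition. *)
Definition dyadic_grid D : Prop :=
  [/\ forall I, D I -> is_interval I /\ exists k : int, mu I = (2 ^ k)%:E,
      forall k0 : int, partition [set I | D I /\ mu I = (2 ^ k0)%:E] id setT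
    & forall I J, D I -> D J -> [\/ I `&` J = set0, I `&` J = I | I `&` J = J]].

Definition len I : R := fine (mu I).

Definition children D I : set (set R) :=
  [set J | [/\ D J, J `<=` I & len J = len I / 2]].

(* In a dyadic grid, I has exactly two children; the right (resp. left) one is
   the one that reaches the right (resp. left) endpoint of I. The default value
   set0 of the description operator is never used for I in a dyadic grid. *)
Definition right_half D I : set R :=
  xget set0 [set J | children D I J /\ sup J = sup I].

Definition left_half D I : set R :=
  xget set0 [set J | children D I J /\ inf J = inf I].

Definition haar D I : R -> R := fun x =>
  len I `^ (- 2^-1) * (\1_(right_half D I) x - \1_(left_half D I) x).

Definition inner f g : R := \int[mu]_(x in setT) (f x * g x).

(* Elements are functions rather than almost-everywhere classes, each class
   having a Borel representative; every condition is invariant under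
   almost-everywhere equality of measurable functions. *)
Definition dyadic_sobolev D s : set (R -> R) :=
  [set f | f \in Lfun mu 2%:E /\
    (\esum_(I in D) (len I `^ (- 2 * s) * `|inner f (haar D I)| ^+ 2)%:E
      < +oo)%E].

Definition closed_under_product (V : set (R -> R)) : Prop :=
  forall f g, V f -> V g -> V (fun x => f x * g x).

End DyadicSobolev.

(* Main.v *)
Require Import Defs.
From HB Require Import structures.
From mathcomp Require Import finmap.
From mathcomp Require Import all_boot all_order all_algebra.
From mathcomp Require Import all_classical all_reals all_analysis.
From mathcomp Require Import measurable_realfun.
From mathcomp Require Import ring lra zify.

Set Implicit Arguments.
Unset Strict Implicit.
Unset Printing Implicit Defensive.

Import Order.TTheory GRing.Theory Num.Theory.
Import numFieldNormedType.Exports.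

Local Open Scope classical_set_scope.
Local Open Scope ring_scope.

(** Write [<f>_I] for the average of [f] over [I], [c_I = (f, h_I)] for the Haar
    coefficients, and [N_f(I)] ([local_norm]) for the square root of the part of
    the Sobolev sum that runs over the grid intervals contained in [I].

    Passing from [I] to one of its two children changes the average by exactly
    [|I|^(-1/2) |c_I|] ([average_child]), hence by at most
    [|I|^(s-1/2) N_f(I)].  As [s > 1/2], these changes form a convergent
    geometric series along a chain of nested intervals shrinking to [x]
    ([average_chain]).  By Lebesgue differentiation the averages tend to [f x]
    for almost every [x], so [|f - <f>_I| <= C |I|^(s-1/2) N_f(I)] almost
    everywhere on [I] ([oscillation_bound]).  On intervals of length [1] this
    shows that [f] is essentially bounded ([sobolev_ae_bounded]), and therefore
    that the product of two elements of the space is square integrable.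

    To bound the Haar coefficients of [f g] on a short interval, one expands,
    with [a = <f>_I] and [b = <g>_I],
      [(f g, h_I) = ((f - a) (g - b), h_I) + a (g, h_I) + b (f, h_I)].
    The last two terms are summable because [a] and [b] are bounded.  By the
    oscillation bound the first one contributes at most
    [C |I|^(2s-1) N_f(I)^2 N_g(I)^2] to the Sobolev sum
    ([coeff_weight_product]).  The intervals of a fixed length are disjoint, so
    [N_f(I)^2] summed over them is at most the full Sobolev sum of [f]
    ([esum_energy_generation]), and the factor [|I|^(2s-1)] decays
    geometrically as the length decreases: this settles the intervals of length
    at most [1] ([esum_small]).

    On a long interval, [|(f g, h_I)|] is at most [|I|^(-1/2)] times the
    integral of [|f g|] over [I].  As [f g] is integrable on the line, the
    contribution of each length is bounded and decays geometrically
    ([esum_large]). *)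

(** * Intervals *)

Lemma interval_sup_inf (R : realType) (I : set R) :
  is_interval I -> I !=set0 -> (lebesgue_measure I < +oo)%E ->
  [/\ has_lbound I, has_ubound I & lebesgue_measure I = (sup I - inf I)%:E].
Proof.
move=> iI I0; rewrite -[in X in (X < _)%E](RhullK (mem_set iI)).
rewrite -[in X in [/\ _, _ & X = _]](RhullK (mem_set iI)).
rewrite !lebesgue_measure_itv/= /Rhull /=.
case: (asboolP (has_lbound I)) => lI; case: (asboolP (has_ubound I)) => uI /=;
  rewrite ?ltNyr ?ltry ?ltxx//=.
move=> _; split => //.
rewrite lte_fin; case: ifPn => [_|]; first by rewrite EFinB.
rewrite -leNgt => h; suff -> : sup I = inf I by rewrite subrr.
apply/eqP; rewrite eq_le h /=.
have [x Ix] := I0.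
by apply: (@le_trans _ _ x); [apply: ge_inf | apply: ub_le_sup].
Qed.

Lemma sup_union (R : realType) (A B : set R) : A !=set0 -> B !=set0 ->
  has_ubound A -> has_ubound B -> sup (A `|` B) = Num.max (sup A) (sup B).
Proof.
move=> [a Aa] [b Bb] uA uB.
have ub : ubound (A `|` B) (Num.max (sup A) (sup B)).
  by move=> x [/(ub_le_sup uA)|/(ub_le_sup uB)] h; rewrite le_max h ?orbT.
apply/eqP; rewrite eq_le ge_sup//=; last by exists a; left.
rewrite ge_max; apply/andP; split; apply: ge_sup => //.
- by exists a.
- by move=> x Ax; apply: ub_le_sup; [exists (Num.max (sup A) (sup B))|left].
- by exists b.
- by move=> x Bx; apply: ub_le_sup; [exists (Num.max (sup A) (sup B))|right].
Qed.

Lemma inf_union (R : realType) (A B : set R) : A !=set0 -> B !=set0 ->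
  has_lbound A -> has_lbound B -> inf (A `|` B) = Num.min (inf A) (inf B).
Proof.
move=> [a Aa] [b Bb] lA lB.
have lb : lbound (A `|` B) (Num.min (inf A) (inf B)).
  by move=> x [/(ge_inf lA)|/(ge_inf lB)] h; rewrite ge_min h ?orbT.
apply/eqP; rewrite eq_le andbC lb_le_inf//=; last by exists a; left.
rewrite le_min; apply/andP; split; apply: lb_le_inf => //.
- by exists a.
- by move=> x Ax; apply: ge_inf; [exists (Num.min (inf A) (inf B))|left].
- by exists b.
- by move=> x Bx; apply: ge_inf; [exists (Num.min (inf A) (inf B))|right].
Qed.

(** * Geometry of dyadic grids *)

Definition generation (R : realType) (D : set (set R)) (k : int) :
    set (set R) :=
  [set I | D I /\ lebesgue_measure I = (2 ^ k)%:E].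

Section DyadicGrid.
Context (R : realType) (D : set (set R)) (hD : dyadic_grid D).
Local Notation mu := (@lebesgue_measure R).

Lemma grid_itv I : D I -> is_interval I.
Proof. by case: hD => h _ _ /h[]. Qed.

Lemma grid_measurable I : D I -> measurable (I : set (measurableTypeR R)).
Proof. by move=> /grid_itv/measurable_realfun.is_interval_measurable. Qed.

Lemma grid_generation I : D I -> exists k : int, generation D k I.
Proof. by case: hD => h _ _ DI; have [_ [k mk]] := h _ DI; exists k. Qed.

Lemma generation_len k I : generation D k I -> len I = 2 ^ k.
Proof. by rewrite /len => -[_ ->]. Qed.

Lemma grid_mu I : D I -> mu I = (len I)%:E.
Proof. by move=> /grid_generation[k [_ h]]; rewrite /len h. Qed.

Lemma len_gt0 I : D I -> 0 < len I.
Proof. by move=> /grid_generation[k /generation_len ->]; rewrite exprz_gt0. Qed.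

Lemma generation_inj k l I : generation D k I -> generation D l I -> k = l.
Proof.
move=> /generation_len + /generation_len; move=> -> /ieexprIz -> //.
by rewrite pnatr_eq1.
Qed.

Lemma generation_cover k x : exists2 I, generation D k I & I x.
Proof.
case: hD => _ /(_ k)[+ _ _] _; move=> /seteqP[_ /(_ x Logic.I)].
by case=> I GI Ix; exists I.
Qed.

Lemma generation_nonempty k I : generation D k I -> I !=set0.
Proof. by case: hD => _ /(_ k)[_ _ h] _ /h. Qed.

Lemma grid_nonempty I : D I -> I !=set0.
Proof. by move=> /grid_generation[k] /generation_nonempty. Qed.

Lemma generation_trivIset k : trivIset (generation D k) id.
Proof. by case: hD => _ /(_ k)[]. Qed.

Lemma generation_eq k I J x : generation D k I -> generation D k J ->
  I x -> J x -> I = J.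
Proof.
by move=> GI GJ Ix Jx; apply: (generation_trivIset GI GJ); exists x.
Qed.

Lemma len_le_sub I J : D I -> D J -> I `<=` J -> len I <= len J.
Proof.
move=> DI DJ IJ; rewrite -lee_fin -!grid_mu//.
by apply: le_measure => //; apply/mem_set; exact: grid_measurable.
Qed.

(** When [I] and [J] meet, the trichotomy for grid intervals leaves only the
    case [J `<=` I] to exclude; then [I] and [J] have the same length, and the
    partition condition makes them equal. *)
Lemma grid_nested I J x : D I -> D J -> I x -> J x -> len I <= len J ->
  I `<=` J.
Proof.
move=> DI DJ Ix Jx leIJ; case: hD => _ _ /(_ _ _ DI DJ)[IJ0|<-|JI].
- by have : set0 x by rewrite -IJ0.
- exact: subIsetr.
have JsI : J `<=` I by rewrite -JI; exact: subIsetl.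
have eqL : mu J = mu I.
  by rewrite !grid_mu//; congr EFin; apply/eqP; rewrite eq_le leIJ len_le_sub.
have [k [_ Ik]] := grid_generation DI.
by rewrite (@generation_eq k I J x)//; split=> //; rewrite eqL.
Qed.

Lemma grid_bounds I : D I ->
  [/\ has_lbound I, has_ubound I & len I = sup I - inf I].
Proof.
move=> DI; have [||] := interval_sup_inf (grid_itv DI).
- exact: grid_nonempty.
- by rewrite grid_mu// ltry.
by rewrite grid_mu// => lI uI [].
Qed.

(** The interval around [x] one generation below [I] meets [I] and is shorter,
    hence lies inside [I]. *)
Lemma child_exists I x : D I -> I x -> exists2 J, children D I J & J x.
Proof.
move=> DI Ix; have [k GI] := grid_generation DI.
have [J GJ Jx] := generation_cover (k - 1) x.
have lJ : len J = len I / 2.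
  by rewrite (generation_len GI) (generation_len GJ) expfzDr// exprN1.
have DJ : D J by case: GJ.
exists J => //; split => //; apply: (grid_nested DJ DI Jx Ix).
by rewrite lJ ler_pdivrMr// ler_peMr ?ler1n// ltW// len_gt0.
Qed.

Lemma children_eq I J K x : D I -> children D I J -> children D I K ->
  J x -> K x -> J = K.
Proof.
move=> DI [DJ _ lJ] [DK _ lK] Jx Kx; have [k GJ] := grid_generation DJ.
apply: (generation_eq GJ _ Jx Kx); split => //.
by case: GJ => _ <-; rewrite !grid_mu// lJ lK.
Qed.

Lemma children_len_lt I J : D I -> children D I J -> len J < len I.
Proof.
move=> DI [_ _ ->]; have := len_gt0 DI; lra.
Qed.

Lemma child_sibling I J : D I -> children D I J ->
  exists2 K, children D I K & K `&` J = set0.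
Proof.
move=> DI cJ; have [DJ JI lJ] := cJ.
have [y [Iy nJy]] : I `\` J !=set0.
  apply/set0P/eqP; rewrite setD_eq0 => IJ.
  by have := children_len_lt DI cJ; rewrite ltNge len_le_sub.
have [K cK Ky] := child_exists DI Iy; exists K => //.
apply/seteqP; split=> // x [Kx Jx].
by apply: nJy; rewrite -(children_eq DI cK cJ Kx Jx).
Qed.

(** Three pairwise disjoint children would have total length [3/2 len I], which
    exceeds that of [I]; and every point of [I] lies in some child. *)
Lemma two_children I J K : D I -> children D I J -> children D I K ->
  K `&` J = set0 -> J `|` K = I /\ forall L, children D I L -> L = J \/ L = K.
Proof.
move=> DI cJ cK KJ.
have only L : children D I L -> L = J \/ L = K.
  move=> cL; apply: contrapT => /not_orP[LJ LK].
  have disj (A B : set R) : children D I A -> children D I B ->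
      A <> B -> A `&` B = set0.
    move=> cA cB AB; apply/seteqP; split=> // x [Ax Bx].
    exact: AB (children_eq DI cA cB Ax Bx).
  have sub : L `|` (K `|` J) `<=` I.
    by case: cJ cK cL => [_ ? _] [_ ? _] [_ ? _]; rewrite !subUset.
  have mm A : children D I A -> measurable (A : set (measurableTypeR R)).
    by case=> DA _ _; exact: grid_measurable.
  have mKJ : measurable (K `|` J : set (measurableTypeR R)).
    by apply: measurableU; exact: mm.
  have : (mu (L `|` (K `|` J)) <= mu I)%E.
    apply: le_measure => //; apply/mem_set; last exact: grid_measurable.
    by apply: measurableU => //; exact: mm.
  have -> : mu (L `|` (K `|` J)) = (mu L + (mu K + mu J))%E.
    rewrite measureU//; [|exact: mm|by rewrite setIUr !disj// setU0].
    by rewrite measureU//; exact: mm.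
  case: cJ cK cL => [DJ _ lJ] [DK _ lK] [DL _ lL].
  rewrite !grid_mu// lJ lK lL -!EFinD lee_fin; have := len_gt0 DI; lra.
split=> //; apply/seteqP; split=> [x []|x Ix].
- by case: cJ => _ + _; apply.
- by case: cK => _ + _; apply.
by have [L /only[->|->]] := child_exists DI Ix; [left|right].
Qed.

(** The larger of the two suprema of the children is [sup I] and the smaller
    of the two infima is [inf I], so both descriptions defining the halves are
    satisfied.  A child sharing both endpoints with [I] would be as long as
    [I], hence the two halves are distinct. *)
Lemma right_left_half I : D I ->
  [/\ children D I (right_half D I), children D I (left_half D I),
      right_half D I `&` left_half D I = set0,
      right_half D I `|` left_half D I = I &
      forall L, children D I L -> L = right_half D I \/ L = left_half D I].
Proof.
move=> DI.
have [x Ix] := grid_nonempty DI.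
have [J cJ _] := child_exists DI Ix.
have [K cK KJ] := child_sibling DI cJ.
have [JKI only] := two_children DI cJ cK KJ.
have [lI uI lenI] := grid_bounds DI.
have [lJ uJ lenJ] := grid_bounds (let: And3 d _ _ := cJ in d).
have [lK uK lenK] := grid_bounds (let: And3 d _ _ := cK in d).
have J0 : J !=set0 by case: cJ => /grid_nonempty.
have K0 : K !=set0 by case: cK => /grid_nonempty.
have supE : exists L, children D I L /\ sup L = sup I.
  rewrite -{2}JKI sup_union//.
  by case: (leP (sup J) (sup K)) => _; [exists K|exists J].
have infE : exists L, children D I L /\ inf L = inf I.
  rewrite -{2}JKI inf_union//.
  by case: (leP (inf J) (inf K)) => _; [exists J|exists K].
have [cr rI] := xgetPex set0 supE.
have [cl lI'] := xgetPex set0 infE.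
rewrite -/(right_half D I) in cr rI; rewrite -/(left_half D I) in cl lI'.
have rl : right_half D I `&` left_half D I = set0.
  apply/seteqP; split=> // y [ry ly].
  have e := children_eq DI cr cl ry ly.
  have := children_len_lt DI cr.
  have [_ _ ->] := grid_bounds (let: And3 d _ _ := cr in d).
  by rewrite rI e lI' lenI ltxx.
have [u o] := two_children DI cl cr rl.
split => //; first by rewrite setUC.
by move=> L /o[->|->]; [right|left].
Qed.

End DyadicGrid.

(** * Averages and Haar coefficients *)

Section Averages.
Context (R : realType) (D : set (set R)) (hD : dyadic_grid D).
Local Notation mu := (@lebesgue_measure R).
Implicit Types (f g : R -> R) (I J : set R) (s : R).

Definition average f I : R := (\int[mu]_(x in I) f x) / len I.

Lemma inner_haar f I : D I -> mu.-integrable I (EFin \o f) ->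
  inner f (haar D I) = len I `^ (- 2^-1) *
    (\int[mu]_(x in right_half D I) f x - \int[mu]_(x in left_half D I) f x).
Proof.
move=> DI fI; have [[Dr rI _] [Dl lI _] _ _ _] := right_left_half hD DI.
have mI := grid_measurable hD DI.
have mr := grid_measurable hD Dr; have ml := grid_measurable hD Dl.
have fr := integrableS mI mr rI fI; have fl := integrableS mI ml lI fI.
have h (A : set (measurableTypeR R)) : measurable A ->
    mu.-integrable A (EFin \o f) -> mu.-integrable setT (EFin \o (f \_ A)).
  by move=> mA; rewrite integrable_mkcond// restrict_EFin.
rewrite /inner /haar (Rintegral_mkcond mu (right_half D I)).
rewrite (Rintegral_mkcond mu (left_half D I)) -RintegralB//; [|exact: h..].
rewrite -RintegralZl//; last first.
  exact: (integrableB measurableT (h _ mr fr) (h _ ml fl)).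
apply: eq_Rintegral => x _; rewrite mulrCA; congr (_ * _).
rewrite mulrBr !patchE !indicE.
by congr (_ - _); case: ifPn; rewrite ?mulr1 ?mulr0.
Qed.

Lemma average_halves f I : D I -> mu.-integrable I (EFin \o f) ->
  \int[mu]_(x in I) f x =
  \int[mu]_(x in right_half D I) f x + \int[mu]_(x in left_half D I) f x.
Proof.
move=> DI fI; have [[Dr rI _] [Dl lI _] rl u _] := right_left_half hD DI.
rewrite -{1}u Rintegral_setU ?u//.
- exact: (grid_measurable hD Dr).
- exact: (grid_measurable hD Dl).
- by apply/disj_setPS; rewrite rl.
Qed.

Lemma powR_half_sq (a : R) : 0 < a -> a `^ (- 2^-1) * a `^ (- 2^-1) = a^-1.
Proof.
move=> a0; rewrite -powRD; last by rewrite (gt_eqF a0) implybT.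
by rewrite (_ : _ + _ = - 1) ?powR_inv1 ?ltW//; lra.
Qed.

(** The average over [I] is the mean of the averages over its halves, from
    which it differs by half their difference; that half-difference is the Haar
    coefficient up to normalization and sign. *)
Lemma average_child f I J : D I -> mu.-integrable I (EFin \o f) ->
  children D I J ->
  `|average f J - average f I| = len I `^ (- 2^-1) * `|inner f (haar D I)|.
Proof.
move=> DI fI cJ; have [cr cl _ _ only] := right_left_half hD DI.
have l0 := len_gt0 hD DI.
rewrite inner_haar// normrM (ger0_norm (powR_ge0 _ _)) mulrA powR_half_sq//.
have -> : (len I)^-1 = `|(len I)^-1| by rewrite ger0_norm// invr_ge0 ltW.
rewrite -normrM /average (average_halves DI fI).
have [_ _ ->] := cJ.
have [->|->] := only _ cJ.
  by congr (`|_|); field; lra.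
by rewrite -normrN; congr (`|_|); field; lra.
Qed.

Definition coeff_weight s f I : R :=
  len I `^ (- 2 * s) * `|inner f (haar D I)| ^+ 2.

Lemma coeff_weight_ge0 s f I : 0 <= coeff_weight s f I.
Proof. by rewrite mulr_ge0 ?powR_ge0 ?exprn_ge0. Qed.

Definition energy s f I : \bar R :=
  (\esum_(J in [set J | D J /\ J `<=` I]) (coeff_weight s f J)%:E)%E.

Lemma energy_ge0 s f I : (0 <= energy s f I)%E.
Proof. by apply: esum_ge0 => J _; rewrite lee_fin coeff_weight_ge0. Qed.

Definition local_norm s f I : R := Num.sqrt (fine (energy s f I)).

Lemma local_norm_ge0 s f I : 0 <= local_norm s f I.
Proof. exact: sqrtr_ge0. Qed.

Lemma energy_le s f I :
  (energy s f I <= \esum_(J in D) (coeff_weight s f J)%:E)%E.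
Proof.
apply: le_trans (_ : _ <= \esum_(J in D)
  if J \in [set J | J `<=` I] then (coeff_weight s f J)%:E else 0)%E _.
  by rewrite -esum_mkcondr.
by apply: le_esum => J _; case: ifPn => //; rewrite lee_fin coeff_weight_ge0.
Qed.

Lemma half_powR_lt1 s : 1 / 2 < s -> 2^-1 `^ (s - 2^-1) < 1 :> R.
Proof.
move=> hs; have : 2^-1 `^ (s - 2^-1) < 1 `^ (s - 2^-1) :> R.
  by apply: gt0_ltr_powR; rewrite ?nnegrE//; lra.
by rewrite powR1.
Qed.

Section Chain.
Context (s : R) (f : R -> R) (s_gt : 1 / 2 < s).
Context (f_int : forall I, D I -> mu.-integrable I (EFin \o f)).
Context (f_energy : (\esum_(J in D) (coeff_weight s f J)%:E < +oo)%E).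

Lemma energy_fin I : energy s f I \is a fin_num.
Proof.
by rewrite ge0_fin_numE ?energy_ge0// (le_lt_trans (energy_le _ _ _)).
Qed.

Lemma local_norm_sq I : (local_norm s f I ^+ 2)%:E = energy s f I.
Proof.
by rewrite sqr_sqrtr ?fineK ?energy_fin// fine_ge0// energy_ge0.
Qed.

Lemma coeff_le_local_norm I J : D J -> J `<=` I ->
  len J `^ (- s) * `|inner f (haar D J)| <= local_norm s f I.
Proof.
move=> DJ JI; rewrite -(@ler_pXn2r _ 2)// ?nnegrE ?local_norm_ge0//; last first.
  by rewrite mulr_ge0 ?powR_ge0.
rewrite -lee_fin local_norm_sq exprMn -powR_mulrn ?powR_ge0// -powRrM.
rewrite (_ : - s * 2%:R = - 2 * s); last by rewrite mulrC mulrN mulNr.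
apply: (@le_trans _ _ (\esum_(K in [set J]) (coeff_weight s f K)%:E)%E).
  by rewrite esum_set1 ?lee_fin ?coeff_weight_ge0.
apply: esum_ge; exists [set J]; last first.
  by rewrite esum_set1 ?fsbig_set1 ?lee_fin ?coeff_weight_ge0.
by split=> // _ ->.
Qed.

Let ratio : R := 2^-1 `^ (s - 2^-1).

Let ratio_gt0 : 0 < ratio. Proof. by rewrite powR_gt0// invr_gt0. Qed.

Let ratio_lt1 : ratio < 1. Proof. exact: half_powR_lt1. Qed.

(** The [n]-th step of the chain changes the average by at most
    [N_f(I) |I|^(s-1/2) ratio^n]; the bound is the partial sum of the resulting
    geometric series, in closed form so that the induction is one identity. *)
Lemma average_chain k I x : generation D k I -> I x ->
  forall n J, generation D (k - n%:Z) J -> J x ->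
  `|average f J - average f I| <=
     local_norm s f I * len I `^ (s - 2^-1) * ((1 - ratio ^+ n) / (1 - ratio)).
Proof.
move=> GI Ix; have DI : D I by case: GI.
elim=> [|n IHn] J GJ Jx.
  rewrite subr0 in GJ; rewrite (generation_eq hD GJ GI Jx Ix).
  by rewrite subrr normr0 expr0 subrr mul0r mulr0.
have [K GK Kx] := generation_cover hD (k - n%:Z) x.
have DK : D K by case: GK.
have DJ : D J by case: GJ.
have lK : len K = len I * 2^-1 ^+ n.
  by rewrite (generation_len GK) (generation_len GI) expfzDr// -exprnN exprVn.
have lJ : len J = len K / 2.
  rewrite (generation_len GK) (generation_len GJ) -exprN1 -expfzDr//.
  by congr (_ ^ _); rewrite intS; ring.
have cJ : children D K J.
  split => //; apply: (grid_nested hD DJ DK Jx Kx).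
  by rewrite lJ; have := len_gt0 hD DK; lra.
have KI : K `<=` I.
  apply: (grid_nested hD DK DI Kx Ix).
  rewrite lK ler_piMr ?(ltW (len_gt0 hD DI))// exprn_ile1//; lra.
have step : `|average f J - average f K| <=
    local_norm s f I * len I `^ (s - 2^-1) * ratio ^+ n.
  rewrite average_child//; last exact: f_int.
  have lK0 := len_gt0 hD DK.
  have -> : len K `^ (- 2^-1) = len K `^ (s - 2^-1) * len K `^ (- s).
    by rewrite -powRD ?(gt_eqF lK0) ?implybT//; congr (_ `^ _); ring.
  rewrite -mulrA mulrC -mulrA.
  apply: ler_pM; rewrite ?mulr_ge0 ?powR_ge0//.
    exact: coeff_le_local_norm.
  rewrite lK powRM ?(ltW (len_gt0 hD DI)) ?exprn_ge0//.
  by rewrite -!powR_mulrn ?(ltW ratio_gt0)// powRAC.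
have -> : average f J - average f I =
  (average f J - average f K) + (average f K - average f I) by ring.
apply: le_trans (ler_normD _ _) _.
apply: le_trans (lerD step (IHn K GK Kx)) _.
rewrite le_eqVlt; apply/orP; left; apply/eqP; rewrite exprS; field.
by rewrite subr_eq0 gt_eqF.
Qed.

End Chain.
End Averages.

(** * Square integrable functions *)

Section SquareIntegrable.
Context {R : realType}.
Local Notation mu := (@lebesgue_measure R).
Implicit Types (f g : R -> R) (A : set (measurableTypeR R)).

Lemma Lfun2_measurable f : f \in Lfun mu 2%:E ->
  measurable_fun (setT : set (measurableTypeR R)) f.
Proof. by rewrite inE => /andP[]; rewrite inE. Qed.

Lemma integrable_cst_on A (c : R) : measurable A -> (mu A < +oo)%E ->
  mu.-integrable A (EFin \o cst c).
Proof.
move=> mA Aoo; apply/integrableP; split; first exact/measurable_EFinP.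
rewrite /= integral_cst// lte_mul_pinfty//.
Qed.

(** On a set of finite measure both terms of [1 + f ^+ 2], which dominates [|f|],
    are integrable. *)
Lemma Lfun2_integrable_on f A : f \in Lfun mu 2%:E ->
  measurable A -> (mu A < +oo)%E -> mu.-integrable A (EFin \o f).
Proof.
move=> f2 mA Aoo; have mf := Lfun2_measurable f2.
apply: (@le_integrable _ _ _ _ _ mA _
  (EFin \o (fun x => 1 + f x ^+ 2))).
- exact/measurable_EFinP/measurable_funTS.
- move=> x _; rewrite /= lee_fin [leRHS]ger0_norm ?addr_ge0 ?sqr_ge0//.
  have := sqr_ge0 (`|f x| - 1); rewrite -(real_normK (num_real (f x))).
  have := normr_ge0 (f x); nra.
apply: (@integrableD _ _ _ _ _ mA (EFin \o cst 1)
  (EFin \o (fun x => f x ^+ 2))).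
  exact: integrable_cst_on.
apply: (integrableS measurableT mA (@subsetT _ A)).
exact: Lfun2_integrable_sqr.
Qed.

Lemma Lfun2_locally_integrable f : f \in Lfun mu 2%:E ->
  locally_integrable setT f.
Proof.
move=> f2; split; [exact: Lfun2_measurable|exact: openT|move=> K _ cK].
by have /integrableP[] := Lfun2_integrable_on f2 (compact_measurable cK)
  (compact_finite_measure cK).
Qed.

End SquareIntegrable.

(** * Oscillation on grid intervals *)

Section Oscillation.
Context (R : realType) (D : set (set R)) (hD : dyadic_grid D).
Local Notation mu := (@lebesgue_measure R).
Implicit Types (f g : R -> R) (I J : set R) (s : R).

(** The intervals of each length cover the line, so the default value [set0] is
    never reached. *)
Definition cell x (n : nat) : set R :=
  xget set0 [set J | generation D (- n%:Z) J /\ J x].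

Lemma cellP x n : generation D (- n%:Z) (cell x n) /\ cell x n x.
Proof.
have [J GJ Jx] := generation_cover hD (- n%:Z) x.
exact: (@xgetI _ set0 [set J | generation D (- n%:Z) J /\ J x] J (conj GJ Jx)).
Qed.

Lemma cell_len x n : len (cell x n) = 2^-1 ^+ n.
Proof. by rewrite (generation_len (cellP x n).1) -exprnN exprVn. Qed.

Lemma grid_sub_ball I x e : D I -> I x -> len I < e -> I `<=` ball x e.
Proof.
move=> DI Ix le y Iy; have [lI uI lenI] := grid_bounds hD DI.
rewrite /ball/= ltr_norml.
have := ub_le_sup uI Ix; have := ub_le_sup uI Iy.
have := ge_inf lI Ix; have := ge_inf lI Iy; move: le; rewrite lenI.
by move=> *; apply/andP; split; lra.
Qed.

Lemma cell_nicely_shrinking x : nicely_shrinking x (cell x).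
Proof.
have Dc n : D (cell x n) by case: (cellP x n) => -[].
split; first by move=> n; exact: (grid_measurable hD (Dc n)).
have r0 n : 0 < 2 * 2^-1 ^+ n :> R by rewrite mulr_gt0// exprn_gt0// invr_gt0.
(* The ball of radius twice the length of the cell has measure four times that
   length. *)
exists (4, fun n => PosNum (r0 n)); split => //=.
- rewrite -[X in _ --> X](mulr0 2); apply: cvgMr; apply: cvg_expr.
  by rewrite ger0_norm ?invr_ge0// invf_lt1// ltr1n.
- move=> n; apply: grid_sub_ball => //; first by case: (cellP x n).
  by rewrite cell_len; have := r0 n; lra.
- move=> n; rewrite lebesgue_measure_ball ?(ltW (r0 n))//.
  rewrite (grid_mu hD (Dc n)) cell_len -EFinM lee_fin -mulr_natl; lra.
Qed.

Context (s : R) (f : R -> R) (s_gt : 1 / 2 < s) (f2 : f \in Lfun mu 2%:E).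
Context (f_energy : (\esum_(J in D) (coeff_weight D s f J)%:E < +oo)%E).

Lemma Lfun2_integrable_grid I : D I -> mu.-integrable I (EFin \o f).
Proof.
move=> DI; apply: Lfun2_integrable_on => //.
  exact: (grid_measurable hD DI).
by rewrite (grid_mu hD DI) ltry.
Qed.

Lemma cvg_average x : lebesgue_pt f x ->
  average f (cell x n) @[n --> \oo] --> f x.
Proof.
move=> /(nice_lebesgue_differentiation cell_nicely_shrinking
  (Lfun2_locally_integrable f2)) /fine_cvgP[_].
apply: cvg_trans; apply: near_eq_cvg; apply: nearW => n /=.
have Dc : D (cell x n) by case: (cellP x n) => -[].
rewrite /average mulrC /Rintegral fineM//; last first.
  apply: integrable_fin_num; first exact: (grid_measurable hD Dc).
  exact: Lfun2_integrable_grid.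
  by rewrite fin_numV ?(grid_mu hD Dc)// ?ltNyr// eqe gt_eqF// (len_gt0 hD Dc).
congr (_ * _).
by rewrite (grid_mu hD Dc) inver gt_eqF ?(len_gt0 hD Dc).
Qed.

(** A cell around [x] not longer than [I] belongs to the chain descending from
    [I] to [x], so its average is within the claimed distance of [<f>_I]; let
    the cell shrink to [x]. *)
Lemma oscillation_bound I x : D I -> I x -> lebesgue_pt f x ->
  `|f x - average f I| <=
    local_norm D s f I * len I `^ (s - 2^-1) / (1 - 2^-1 `^ (s - 2^-1)).
Proof.
move=> DI Ix /cvg_average fx; have [k GI] := grid_generation hD DI.
set B := leRHS.
have near_le : \forall n \near \oo, `|average f (cell x n) - average f I| <= B.
  exists `|k|%N => // n /= kn.
  have [GC Cx] := cellP x n.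
  have [m km] : exists m : nat, k - m%:Z = - n%:Z.
    exists (absz (k + n%:Z)); lia.
  rewrite -km in GC.
  apply: le_trans (average_chain hD s_gt Lfun2_integrable_grid f_energy
    GI Ix GC Cx) _.
  rewrite mulrA ler_pM2r ?invr_gt0 ?subr_gt0 ?half_powR_lt1//.
  rewrite ler_piMr ?mulr_ge0 ?powR_ge0 ?local_norm_ge0//.
apply: (@cvgr_to_le _ \oo _ _
  (fun n => `|average f (cell x n) - average f I|)) near_le.
by apply: cvg_norm; apply: cvgB => //; exact: cvg_cst.
Qed.


End Oscillation.

(** * Essential boundedness *)

Section EssentialBounds.
Context (R : realType).
Local Notation mu := (@lebesgue_measure R).
Implicit Types (f g : R -> R) (A : set (measurableTypeR R)).

Lemma Rintegral_ae_bound f A (M : R) : measurable A -> (mu A < +oo)%E ->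
  mu.-integrable A (EFin \o f) -> 0 <= M ->
  {ae mu, forall x, A x -> `|f x| <= M} ->
  `|\int[mu]_(x in A) f x| <= M * fine (mu A).
Proof.
move=> mA Aoo fA M0 fM; rewrite -lee_fin EFin_normr_Rintegral//.
have mf : measurable_fun A (EFin \o f) by case/integrableP: fA.
apply: le_trans (le_abse_integral _ mA mf) _.
rewrite EFinM fineK ?ge0_fin_numE// -integral_cst//.
apply: ae_ge0_le_integral => //.
- by apply: measurableT_comp => //; exact: mf.
Qed.

Lemma Lfun2_integrable_sqr_converse f :
  measurable_fun (setT : set (measurableTypeR R)) f ->
  mu.-integrable setT (EFin \o (fun x => f x ^+ 2)) -> f \in Lfun mu 2%:E.
Proof.
move=> mf /integrableP[_ foo]; rewrite inE; apply/andP; split; rewrite inE//=.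
rewrite /finite_norm unlock/= poweR_lty//; apply: le_lt_trans foo.
rewrite le_eqVlt; apply/orP; left; apply/eqP; apply: eq_integral => x _ /=.
by rewrite normrX powR_mulrn.
Qed.

Lemma Lfun2_mul_bounded f g (M : R) :
  f \in Lfun mu 2%:E -> g \in Lfun mu 2%:E ->
  {ae mu, forall x, `|f x| <= M} -> (fun x => f x * g x) \in Lfun mu 2%:E.
Proof.
move=> f2 g2 fM; have mf := Lfun2_measurable f2; have mg := Lfun2_measurable g2.
have mfg : measurable_fun (setT : set (measurableTypeR R)) (fun x => f x * g x).
  exact: measurable_funM.
apply: Lfun2_integrable_sqr_converse => //; apply/integrableP; split.
  by apply/measurable_EFinP; exact: measurable_funX.
have /(integrableZl measurableT (M ^+ 2)) /integrableP[_] :=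
  Lfun2_integrable_sqr g2.
apply: le_lt_trans; apply: ae_ge0_le_integral => //.
- apply: measurableT_comp => //; apply/measurable_EFinP; exact: measurable_funX.
- apply: measurableT_comp => //; apply: emeasurable_funM => //.
  by apply/measurable_EFinP; exact: measurable_funX.
- move: fM; apply: (@filterS _ _ (ae_filter_ringOfSetsType mu)) => x fx _.
  rewrite /= lee_fin.
  rewrite [leLHS]ger0_norm ?sqr_ge0// [leRHS]ger0_norm; last first.
    by rewrite mulr_ge0 ?sqr_ge0.
  rewrite exprMn ler_wpM2r ?sqr_ge0// -(real_normK (num_real (f x))).
  by rewrite ler_pXn2r ?nnegrE// (le_trans _ fx).
Qed.

End EssentialBounds.

Section Bounded.
Context (R : realType) (D : set (set R)) (hD : dyadic_grid D).
Context (s : R) (s_gt : 1 / 2 < s).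
Local Notation mu := (@lebesgue_measure R).
Implicit Types (f g : R -> R) (I J : set R).

(** Apply the oscillation bound on the interval of length [1] around each
    Lebesgue point: there the average is at most [1 + int f^2], and [N_f] is
    dominated by the full Sobolev sum. *)
Lemma sobolev_ae_bounded f : dyadic_sobolev D s f ->
  exists2 M, 0 <= M & {ae mu, forall x, `|f x| <= M}.
Proof.
move=> [f2 fE].
set T := (\esum_(J in D) (coeff_weight D s f J)%:E)%E in fE.
have T0 : (0 <= T)%E.
  by apply: esum_ge0 => J _; rewrite lee_fin coeff_weight_ge0.
pose F := \int[mu]_x (f x ^+ 2).
have F0 : 0 <= F by apply: Rintegral_ge0 => x _; exact: sqr_ge0.
have r1 : 0 < 1 - 2^-1 `^ (s - 2^-1) :> R by rewrite subr_gt0 half_powR_lt1.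
exists (1 + F + Num.sqrt (fine T) / (1 - 2^-1 `^ (s - 2^-1))).
  by rewrite !addr_ge0 ?divr_ge0 ?sqrtr_ge0// ltW.
have := lebesgue_differentiation (Lfun2_locally_integrable f2).
apply: (@filterS _ _ (ae_filter_ringOfSetsType mu)) => x fx.
set I := cell D x 0.
have [[DI _] Ix] : generation D (- 0%:Z) I /\ I x := cellP hD x 0.
have lI : len I = 1 by rewrite (cell_len hD x 0) expr0.
have mI := grid_measurable hD DI.
have muI : mu I = 1%:E by rewrite (grid_mu hD DI) lI.
have muIoo : (mu I < +oo)%E by rewrite muI ltry.
have osc := oscillation_bound hD s_gt f2 fE DI Ix fx.
rewrite lI powR1 mulr1 in osc.
have fI := Lfun2_integrable_on f2 mI muIoo.
have f2I := integrableS measurableT mI (@subsetT _ I) (Lfun2_integrable_sqr f2).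
have avg : `|average f I| <= 1 + F.
  rewrite /average lI divr1; apply: le_trans (le_normr_Rintegral mI fI) _.
  apply: (@le_trans _ _ (\int[mu]_(x in I) (1 + f x ^+ 2))).
    apply: le_Rintegral => //.
    - exact: integrable_norm.
    - apply: (@integrableD _ _ _ _ _ mI (EFin \o cst 1)
        (EFin \o (fun x => f x ^+ 2))) => //.
      exact: integrable_cst_on.
    - move=> y _; have := sqr_ge0 (`|f y| - 1).
      rewrite -(real_normK (num_real (f y))); have := normr_ge0 (f y); nra.
  rewrite RintegralD//; last exact: (@integrable_cst_on _ I 1).
  rewrite Rintegral_cst// [X in 1 * X](_ : _ = 1) ?lI// mul1r lerD2l fine_le//.
  - exact: integrable_fin_num.
  - by apply: integrable_fin_num => //; exact: Lfun2_integrable_sqr.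
  - apply: ge0_subset_integral => //.
      apply/measurable_EFinP; apply: measurable_funX.
      exact: Lfun2_measurable.
    by move=> y _; rewrite lee_fin sqr_ge0.
have loc : local_norm D s f I <= Num.sqrt (fine T).
  rewrite ler_sqrt ?fine_ge0// fine_le ?energy_le//.
    exact: (energy_fin fE).
  by rewrite ge0_fin_numE.
rewrite -(subrK (average f I) (f x)) addrC; apply: le_trans (ler_normD _ _) _.
rewrite lerD//; apply: le_trans osc _.
by rewrite ler_pM2r ?invr_gt0.
Qed.

Lemma average_bound f (M : R) I : f \in Lfun mu 2%:E -> 0 <= M ->
  {ae mu, forall x, `|f x| <= M} -> D I -> `|average f I| <= M.
Proof.
move=> f2 M0 fM DI; have l0 := len_gt0 hD DI.
rewrite /average normrM normfV [X in _ / X]gtr0_norm// ler_pdivrMr//.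
apply: Rintegral_ae_bound => //; first exact: (grid_measurable hD DI).
  by rewrite (grid_mu hD DI) ltry.
  exact: (Lfun2_integrable_grid hD f2 DI).
by move: fM; apply: (@filterS _ _ (ae_filter_ringOfSetsType mu)) => x fx _.
Qed.

End Bounded.

(** * Sums over the generations of the grid *)

Section Sums.
Context (R : realType) (T : choiceType).
Implicit Types (A B : set T) (F : T -> \bar R).
Local Open Scope ereal_scope.

Lemma esum_subset A B F : A `<=` B ->
  \esum_(i in A) F i <= \esum_(i in B) F i.
Proof.
move=> AB; apply: le_ereal_sup => _ [X [fX XA] <-]; exists X => //.
by split => //; exact: subset_trans AB.
Qed.

Lemma esumZl_le A F (c : R) : (0 <= c)%R -> (forall i, 0 <= F i) ->
  \esum_(i in A) (c%:E * F i) <= c%:E * \esum_(i in A) F i.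
Proof.
move=> c0 F0; apply: ge_ereal_sup => _ [X XA <-].
rewrite -ge0_mule_fsumr//; apply: lee_wpmul2l; first by rewrite lee_fin.
by apply: ereal_sup_ubound; exists X.
Qed.

Lemma esum_geometric (A : nat -> set T) F (C q : R) :
  trivIset setT A -> (forall i, 0 <= F i) -> (0 <= C)%R -> (0 <= q < 1)%R ->
  (forall n, \esum_(i in A n) F i <= (C * q ^+ n)%:E) ->
  \esum_(i in \bigcup_n A n) F i < +oo.
Proof.
move=> tA F0 C0 /andP[q0 q1] FC; rewrite esum_bigcupT//.
rewrite -nneseries_esumT; last by move=> n; exact: esum_ge0.
apply: (@le_lt_trans _ _ (C / (1 - q))%:E); last exact: ltry.
apply: lime_le; first by apply: is_cvg_nneseries => n _ _; exact: esum_ge0.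
apply: nearW => n; apply: le_trans (lee_sum _ (fun i _ => FC i)) _.
rewrite sumEFin lee_fin.
have -> : (\sum_(0 <= i < n) C * q ^+ i = series (geometric C q) n)%R by [].
rewrite geometric_seriesE ?lt_eqF//= ler_pM2r ?invr_gt0 ?subr_gt0//.
by rewrite ler_piMr// gerBl exprn_ge0.
Qed.

End Sums.

Section GenerationSums.
Context (R : realType) (D : set (set R)) (hD : dyadic_grid D).
Local Notation mu := (@lebesgue_measure R).
Implicit Types (f g : R -> R) (I J : set R).

Lemma trivIset_generation (k : nat -> int) : injective k ->
  trivIset setT (generation D \o k).
Proof.
move=> kinj m n _ _ [I [/= GI GI']].
by apply: kinj; exact: (generation_inj GI GI').
Qed.

(** The sum runs over pairs [(I, J)] with [J] inside [I]; since [J] is nonempty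
    and the intervals of a generation are disjoint, [J] determines [I], so each
    weight is counted at most once. *)
Lemma esum_energy_generation k s f :
  (\esum_(I in generation D k) energy D s f I <=
   \esum_(J in D) (coeff_weight D s f J)%:E)%E.
Proof.
rewrite /energy esum_esum; last first.
  by move=> I J _ _; rewrite lee_fin coeff_weight_ge0.
rewrite -(esum_image _ snd (fun J => (coeff_weight D s f J)%:E)).
  by apply: esum_subset => _ [[I J] /= [_ [DJ _]] <-].
move=> [I J] [I' J'] /set_mem[/= GI [DJ JI]] /set_mem[/= GI' [_ J'I']] /= e.
have [x Jx] := grid_nonempty hD DJ.
have -> : I = I'.
  by apply: (generation_eq hD GI GI' (JI _ Jx)); apply: J'I'; rewrite -e.
by rewrite e.
Qed.

Lemma esum_integral_generation k f : mu.-integrable setT (EFin \o f) ->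
  (\esum_(I in generation D k) \int[mu]_(x in I) `|f x|%:E <=
   \int[mu]_x `|f x|%:E)%E.
Proof.
move=> /integrableP[mf _]; apply: ge_ereal_sup => _ [X [fX XG] <-].
have mnf : measurable_fun (setT : set (measurableTypeR R))
    (fun x => `|f x|%:E : \bar R).
  apply/measurable_EFinP; apply: measurableT_comp => //.
  exact/measurable_EFinP.
(* [F] is the identity on the grid and takes measurable values on all sets. *)
pose F (I : set (measurableTypeR R)) := if I \in D then I else set0.
have mF I : measurable (F I).
  by rewrite /F; case: ifPn => // /set_mem DI; exact: (grid_measurable hD DI).
have FX I : I \in fset_set X -> F I = I.
  by rewrite in_fset_set// => /set_mem/XG[DI _]; rewrite /F mem_set.
rewrite fsbig_finite//= big_seq.
rewrite (eq_bigr (fun I => \int[mu]_(x in F I) `|f x|%:E)%E).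
  rewrite -big_seq -(@ge0_integral_bigsetU _ _ _ mu _ F)//.
  - apply: ge0_subset_integral => //.
  by apply: bigsetU_measurable => I _; exact: mF.
  - exact: fset_uniq.
  - move=> I J /= IX JX; rewrite (FX _ IX) (FX _ JX).
  move: IX JX; rewrite !in_fset_set// => /set_mem/XG GI /set_mem/XG GJ.
  exact: (generation_trivIset hD GI GJ).
  - exact: measurable_funTS.
by move=> I IX; rewrite FX.
Qed.

End GenerationSums.

(** * Long intervals *)

Section Coefficients.
Context (R : realType) (D : set (set R)) (hD : dyadic_grid D) (s : R).
Local Notation mu := (@lebesgue_measure R).
Implicit Types (f g h : R -> R) (I J : set R).

Lemma coeff_le_integral h I : D I -> mu.-integrable I (EFin \o h) ->
  `|inner h (haar D I)| <= len I `^ (- 2^-1) * \int[mu]_(x in I) `|h x|.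
Proof.
move=> DI hI; rewrite (inner_haar hD)// normrM (ger0_norm (powR_ge0 _ _)).
rewrite ler_wpM2l ?powR_ge0//.
have mI := grid_measurable hD DI.
rewrite (average_halves hD DI (integrable_norm hI)).
have [[Dr rI _] [Dl lI _] _ _ _] := right_left_half hD DI.
have mr := grid_measurable hD Dr; have ml := grid_measurable hD Dl.
apply: le_trans (ler_normB _ _) _; apply: lerD; apply: le_normr_Rintegral => //.
- exact: (integrableS mI mr rI hI).
- exact: (integrableS mI ml lI hI).
Qed.

(** The weight is at most [|I|^-1 (int_I |h|)^2] since [|I|^(-2s) <= 1]; one of
    the two integrals over [I] is enlarged to the whole line, the other is kept
    because it is additive over a generation. *)
Lemma coeff_weight_large h I : 0 <= s -> mu.-integrable setT (EFin \o h) ->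
  D I -> 1 <= len I ->
  coeff_weight D s h I <=
    (len I)^-1 * (\int[mu]_x `|h x|) * \int[mu]_(x in I) `|h x|.
Proof.
move=> s0 hT DI l1; have l0 := len_gt0 hD DI.
have mI := grid_measurable hD DI.
have hI : mu.-integrable I (EFin \o h).
  exact: (integrableS measurableT mI (@subsetT _ I)).
set A := \int[mu]_x _; set a := \int[mu]_(x in I) _.
have a0 : 0 <= a by exact: Rintegral_ge0.
have aA : a <= A.
  rewrite /a /A fine_le//.
  - by apply: integrable_fin_num => //; exact: integrable_norm.
  - by apply: integrable_fin_num => //; exact: integrable_norm.
  - apply: ge0_subset_integral => //.
    apply: measurableT_comp => //; apply: measurableT_comp => //.
    by case/integrableP: hT => /measurable_EFinP.
have c := coeff_le_integral DI hI.
apply: (@le_trans _ _ (1 * ((len I)^-1 * (a * a)))).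
  apply: ler_pM; rewrite ?powR_ge0 ?exprn_ge0//.
    by rewrite -[leRHS](powRr0 (len I)) ler_powR//; lra.
  rewrite -(powR_half_sq l0) -/a in c *.
  rewrite (_ : _ * _ * _ = (len I `^ (- 2^-1) * a) ^+ 2); last by ring.
  by rewrite ler_pXn2r// nnegrE// mulr_ge0 ?powR_ge0.
by rewrite mul1r -mulrA ler_wpM2l ?invr_ge0 ?(ltW l0)// ler_wpM2r.
Qed.

Lemma esum_large h : 0 <= s -> mu.-integrable setT (EFin \o h) ->
  (\esum_(I in \bigcup_(n : nat) generation D n.+1%:Z)
    (coeff_weight D s h I)%:E < +oo)%E.
Proof.
move=> s0 hT; set A := \int[mu]_x `|h x|.
have A0 : 0 <= A by exact: Rintegral_ge0.
apply: (@esum_geometric _ _ _ _ (A * A) 2^-1).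
- by apply: trivIset_generation => m n [].
- by move=> I; rewrite lee_fin coeff_weight_ge0.
- exact: mulr_ge0.
- by apply/andP; split; lra.
move=> n; apply: (@le_trans _ _ (\esum_(I in generation D n.+1%:Z)
    ((2^-1 ^+ n * A)%:E * \int[mu]_(x in I) `|h x|%:E))%E).
  apply: le_esum => I GI; have DI : D I by case: GI.
  have mI := grid_measurable hD DI.
  have hI : mu.-integrable I (EFin \o h).
    exact: (integrableS measurableT mI (@subsetT _ I)).
  have lI : len I = 2 ^+ n.+1 by rewrite (generation_len GI).
  have fin : (\int[mu]_(x in I) `|h x|%:E)%E \is a fin_num.
    by apply: integrable_fin_num => //; exact: (integrable_norm hI).
  rewrite -(fineK fin) -EFinM lee_fin.
  apply: le_trans (coeff_weight_large s0 hT DI _) _.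
    by rewrite lI exprn_ege1// ler1n.
  rewrite -/A ler_wpM2r//; first exact: Rintegral_ge0.
  rewrite ler_wpM2r// lI -exprVn exprS ler_piMl ?exprn_ge0//; lra.
apply: le_trans (esumZl_le _ _ _) _.
- by rewrite mulr_ge0// exprn_ge0.
- by move=> I; exact: integral_ge0.
apply: (@le_trans _ _ ((2^-1 ^+ n * A)%:E * A%:E)%E).
  apply: lee_wpmul2l; first by rewrite lee_fin mulr_ge0// exprn_ge0.
  rewrite fineK; first exact: esum_integral_generation.
  by apply: integrable_fin_num => //; exact: integrable_norm.
by rewrite -EFinM lee_fin; rewrite le_eqVlt; apply/orP; left; apply/eqP; ring.
Qed.

End Coefficients.

(** * The Haar coefficients of a product *)

Section ProductExpansion.
Context (R : realType).
Local Notation mu := (@lebesgue_measure R).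
Implicit Types (f g : R -> R) (A : set (measurableTypeR R)).

Lemma Rintegral_centered_product f g A (a b : R) :
  measurable A -> (mu A < +oo)%E ->
  mu.-integrable A (EFin \o f) -> mu.-integrable A (EFin \o g) ->
  mu.-integrable A (EFin \o (fun x => f x * g x)) ->
  mu.-integrable A (EFin \o (fun x => (f x - a) * (g x - b))) /\
  \int[mu]_(x in A) ((f x - a) * (g x - b)) =
    \int[mu]_(x in A) (f x * g x) -
    (a * \int[mu]_(x in A) g x + b * \int[mu]_(x in A) f x) +
    a * b * fine (mu A).
Proof.
move=> mA Aoo fA gA fgA.
have -> : (fun x => (f x - a) * (g x - b)) =
    (fun x => f x * g x - (a * g x + b * f x) + a * b).
  by apply/funext => x; ring.
have i1 : mu.-integrable A (EFin \o (fun x => a * g x)) := integrableZl mA a gA.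
have i2 : mu.-integrable A (EFin \o (fun x => b * f x)) := integrableZl mA b fA.
have i3 : mu.-integrable A (EFin \o (fun x => a * g x + b * f x)) :=
  integrableD mA i1 i2.
have i4 : mu.-integrable A
    (EFin \o (fun x => f x * g x - (a * g x + b * f x))) :=
  integrableB mA fgA i3.
have i5 : mu.-integrable A (EFin \o (fun=> a * b)) :=
  integrable_cst_on (a * b) mA Aoo.
split; first exact: (integrableD mA i4 i5).
rewrite RintegralD// Rintegral_cst//.
by rewrite RintegralB// RintegralD// !RintegralZl.
Qed.

End ProductExpansion.

Section ProductCoefficient.
Context (R : realType) (D : set (set R)) (hD : dyadic_grid D).
Local Notation mu := (@lebesgue_measure R).
Implicit Types (f g : R -> R) (I J : set R).

(** Expand [f g] around [a = <f>_I] and [b = <g>_I]: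
    [f g = (f - a) (g - b) + a g + b f - a b], where the constant is orthogonal
    to [h_I] because the two halves of [I] have equal length. *)
Lemma coeff_product_le f g I (Of Og : R) : D I ->
  f \in Lfun mu 2%:E -> g \in Lfun mu 2%:E -> 0 <= Of -> 0 <= Og ->
  {ae mu, forall x, I x -> `|f x - average f I| <= Of} ->
  {ae mu, forall x, I x -> `|g x - average g I| <= Og} ->
  `|inner (fun x => f x * g x) (haar D I)| <=
    len I `^ 2^-1 * (Of * Og) + `|average f I| * `|inner g (haar D I)| +
    `|average g I| * `|inner f (haar D I)|.
Proof.
move=> DI f2 g2 Of0 Og0 fO gO.
have l0 := len_gt0 hD DI.
have mI := grid_measurable hD DI.
have fI := Lfun2_integrable_grid hD f2 DI.
have gI := Lfun2_integrable_grid hD g2 DI.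
have fgI : mu.-integrable I (EFin \o (fun x => f x * g x)).
  apply: (integrableS measurableT mI (@subsetT _ I)).
  exact/Lfun1_integrable/Lfun2_mul_Lfun1.
rewrite !(inner_haar hD)//.
set a := average f I; set b := average g I; rewrite -/a -/b in fO gO *.
have half J : children D I J ->
    exists2 e, `|e| <= Of * Og * (len I / 2) &
    \int[mu]_(x in J) (f x * g x) = e + (a * \int[mu]_(x in J) g x +
      b * \int[mu]_(x in J) f x) - a * b * (len I / 2).
  move=> [DJ JI lJ]; have mJ := grid_measurable hD DJ.
  have Joo : (mu J < +oo)%E by rewrite (grid_mu hD DJ) ltry.
  have [iP eP] := Rintegral_centered_product a b mJ Joo
    (integrableS mI mJ JI fI) (integrableS mI mJ JI gI)
    (integrableS mI mJ JI fgI).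
  exists (\int[mu]_(x in J) ((f x - a) * (g x - b))); last first.
    rewrite eP (_ : fine (mu J) = len I / 2); last exact: lJ.
    by ring.
  rewrite -lJ; apply: Rintegral_ae_bound => //; first exact: mulr_ge0.
  move: fO gO; apply: (@filterS2 _ _ (ae_filter_ringOfSetsType mu)).
  by move=> x fx gx /JI Ix; rewrite normrM ler_pM ?fx ?gx.
have [cr cl _ _ _] := right_left_half hD DI.
have [er er_le ->] := half _ cr.
have [el el_le ->] := half _ cl.
set gr := \int[mu]_(x in right_half D I) g x.
set gl := \int[mu]_(x in left_half D I) g x.
set fr := \int[mu]_(x in right_half D I) f x.
set fl := \int[mu]_(x in left_half D I) f x.
set w := len I `^ (- 2^-1).
have w0 : 0 <= w by exact: powR_ge0.
rewrite (_ : w * _ =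
  w * (er - el) + a * (w * (gr - gl)) + b * (w * (fr - fl))); last by ring.
apply: le_trans (ler_normD _ _) _; rewrite lerD ?normrM//.
apply: le_trans (ler_normD _ _) _; rewrite lerD ?normrM//.
rewrite (ger0_norm w0) (_ : len I `^ 2^-1 = w * len I); last first.
  rewrite -[X in w * X](powRr1 (ltW l0)) -powRD ?(gt_eqF l0) ?implybT//.
  by congr (_ `^ _); lra.
rewrite -mulrA ler_wpM2l//; apply: le_trans (ler_normB _ _) _.
apply: le_trans (lerD er_le el_le) _.
by rewrite le_eqVlt; apply/orP; left; apply/eqP; field.
Qed.

End ProductCoefficient.

Lemma sqr_sum3_le (R : realFieldType) (x y z : R) :
  (x + y + z) ^+ 2 <= 3 * (x ^+ 2 + y ^+ 2 + z ^+ 2).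
Proof.
have := sqr_ge0 (x - y); have := sqr_ge0 (y - z); have := sqr_ge0 (x - z); nra.
Qed.

(** * Products in the Sobolev space *)

Section Product.
Context (R : realType) (D : set (set R)) (hD : dyadic_grid D).
Context (s : R) (s_gt : 1 / 2 < s).
Local Notation mu := (@lebesgue_measure R).
Implicit Types (f g : R -> R) (I J : set R).

Let total f : \bar R := (\esum_(J in D) (coeff_weight D s f J)%:E)%E.

(* The sum of the geometric series in the oscillation bound. *)
Let kappa : R := (1 - 2^-1 `^ (s - 2^-1))^-1.

Let kappa_ge0 : 0 <= kappa.
Proof. by rewrite invr_ge0 subr_ge0 ltW// half_powR_lt1. Qed.

Lemma total_fin f : dyadic_sobolev D s f -> total f \is a fin_num.
Proof.
move=> [_ fE]; rewrite ge0_fin_numE//.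
by apply: esum_ge0 => J _; rewrite lee_fin coeff_weight_ge0.
Qed.

Lemma local_norm_sq_le f I : dyadic_sobolev D s f ->
  local_norm D s f I ^+ 2 <= fine (total f).
Proof.
move=> sf; have [_ fE] := sf; rewrite -lee_fin (local_norm_sq fE).
rewrite fineK ?total_fin//.
exact: energy_le.
Qed.

Lemma ae_oscillation f I : dyadic_sobolev D s f -> D I ->
  {ae mu, forall x, I x -> `|f x - average f I| <=
    local_norm D s f I * len I `^ (s - 2^-1) * kappa}.
Proof.
move=> [f2 fE] DI.
have := lebesgue_differentiation (Lfun2_locally_integrable f2).
apply: (@filterS _ _ (ae_filter_ringOfSetsType mu)) => x fx Ix.
exact: (oscillation_bound hD s_gt f2 fE DI Ix fx).
Qed.

(** In the first term the powers of [|I|] combine to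
    [|I|^(-2s) (|I|^(1/2) |I|^(2s-1))^2 = |I|^(2s-1)], the weight, the
    normalization of [h_I] and the two oscillations being accounted for; [N_g^2]
    is bounded by the full Sobolev sum of [g], while [N_f] is kept for the
    summation over [I]. *)
Lemma coeff_weight_product f g (M N : R) I :
  dyadic_sobolev D s f -> dyadic_sobolev D s g -> 0 <= M -> 0 <= N ->
  {ae mu, forall x, `|f x| <= M} -> {ae mu, forall x, `|g x| <= N} -> D I ->
  coeff_weight D s (fun x => f x * g x) I <=
    3 * kappa ^+ 4 * fine (total g) *
      ((len I `^ (s - 2^-1)) ^+ 2 * local_norm D s f I ^+ 2) +
    (3 * M ^+ 2 * coeff_weight D s g I + 3 * N ^+ 2 * coeff_weight D s f I).
Proof.
move=> sf sg M0 N0 fM gN DI; have l0 := len_gt0 hD DI.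
have [f2 fE] := sf; have [g2 gE] := sg.
set p := len I `^ (s - 2^-1).
have p0 : 0 <= p by exact: powR_ge0.
have nf0 := local_norm_ge0 D s f I; have ng0 := local_norm_ge0 D s g I.
have O0 h : 0 <= local_norm D s h I * p * kappa.
  by rewrite !mulr_ge0 ?local_norm_ge0.
have c_le := coeff_product_le hD DI f2 g2 (O0 f) (O0 g)
  (ae_oscillation sf DI) (ae_oscillation sg DI).
have aM := average_bound hD f2 M0 fM DI.
have bN := average_bound hD g2 N0 gN DI.
rewrite /coeff_weight.
set cf := `|inner f _| in c_le *; set cg := `|inner g _| in c_le *.
set c := `|inner _ _| in c_le *.
have [cf0 cg0 c0] : [/\ 0 <= cf, 0 <= cg & 0 <= c] by split; exact: normr_ge0.
set u := len I `^ (- s).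
have u0 : 0 <= u by exact: powR_ge0.
have u2 : len I `^ (- 2 * s) = u ^+ 2.
  rewrite -powR_mulrn// -powRrM; congr (_ `^ _).
  by rewrite mulNr mulrC -mulNr.
have upl : u * (len I `^ 2^-1 * p) = 1.
  rewrite /u /p -!powRD ?(gt_eqF l0) ?implybT//.
  by rewrite (_ : _ + _ = 0) ?powRr0//; ring.
have {}c_le : u * c <=
    local_norm D s f I * local_norm D s g I * p * kappa ^+ 2
    + M * (u * cg) + N * (u * cf).
  apply: (@le_trans _ _ (u * (len I `^ 2^-1 *
    (local_norm D s f I * p * kappa * (local_norm D s g I * p * kappa)) +
    M * cg + N * cf))).
    rewrite ler_wpM2l//; apply: le_trans c_le _.
    by rewrite !lerD// ler_wpM2r.
  rewrite le_eqVlt; apply/orP; left; apply/eqP.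
  transitivity (u * (len I `^ 2^-1 * p) *
    (local_norm D s f I * local_norm D s g I * p * kappa ^+ 2) +
    M * (u * cg) + N * (u * cf)); [ring | by rewrite upl mul1r].
rewrite u2 -!exprMn.
apply: (@le_trans _ _ ((local_norm D s f I * local_norm D s g I * p * kappa ^+ 2
    + M * (u * cg) + N * (u * cf)) ^+ 2)).
  rewrite ler_pXn2r ?nnegrE ?mulr_ge0//.
  by rewrite !addr_ge0 ?mulr_ge0 ?exprn_ge0.
apply: le_trans (sqr_sum3_le _ _ _) _.
have := local_norm_sq_le I sg; set Ng := local_norm D s g I.
set Tg := fine _ => NgT.
have X0 : 0 <= kappa ^+ 4 * (p * local_norm D s f I) ^+ 2.
  by rewrite mulr_ge0 ?exprn_ge0// mulr_ge0.
have : kappa ^+ 4 * (p * local_norm D s f I) ^+ 2 * Ng ^+ 2 <=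
  kappa ^+ 4 * (p * local_norm D s f I) ^+ 2 * Tg by rewrite ler_wpM2l.
move=> H; lra.
Qed.

(** On the generation of length [2^-n] the factor [|I|^(2s-1)] equals [q^n]
    with [q < 1], and [N_f^2] sums to at most the full Sobolev sum of [f]. *)
Lemma esum_small f g : dyadic_sobolev D s f -> dyadic_sobolev D s g ->
  (\esum_(I in \bigcup_(n : nat) generation D (- n%:Z))
    (coeff_weight D s (fun x => f x * g x) I)%:E < +oo)%E.
Proof.
move=> sf sg; have [f2 fE] := sf; have [g2 gE] := sg.
have [M M0 fM] := sobolev_ae_bounded hD s_gt sf.
have [N N0 gN] := sobolev_ae_bounded hD s_gt sg.
set S := \bigcup_n _.
have SD : S `<=` D by move=> I [n _ []].
set K := 3 * kappa ^+ 4 * fine (total g).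
have T0 h : 0 <= fine (total h).
  by rewrite fine_ge0// esum_ge0// => J _; rewrite lee_fin coeff_weight_ge0.
have K0 : 0 <= K by rewrite !mulr_ge0 ?exprn_ge0.
pose F1 I := ((len I `^ (s - 2^-1)) ^+ 2 * local_norm D s f I ^+ 2)%:E.
have F1_ge0 I : (0 <= F1 I)%E.
  by rewrite lee_fin mulr_ge0// exprn_ge0// ?powR_ge0// local_norm_ge0.
have w_ge0 h (I : set R) : (0 <= (coeff_weight D s h I)%:E)%E.
  by rewrite lee_fin coeff_weight_ge0.
have F1_fin : (\esum_(I in S) F1 I < +oo)%E.
  pose q : R := (2^-1 `^ (s - 2^-1)) ^+ 2.
  apply: (@esum_geometric _ _ _ _ (fine (total f)) q) => //.
  - by apply: trivIset_generation => m n; lia.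
  - rewrite /q exprn_ge0 ?powR_ge0//= exprn_ilt1 ?powR_ge0//.
    exact: half_powR_lt1.
  move=> n; apply: (@le_trans _ _ (\esum_(I in generation D (- n%:Z))
      ((q ^+ n)%:E * energy D s f I))%E).
    apply: le_esum => I GI; rewrite -(local_norm_sq fE) -EFinM lee_fin.
    have -> : len I `^ (s - 2^-1) = (2^-1 `^ (s - 2^-1)) ^+ n.
      rewrite (generation_len GI) -exprnN -exprVn -!powR_mulrn ?powR_ge0//.
      by rewrite powRAC.
    by rewrite /q -!exprM mulnC.
  apply: (le_trans (@esumZl_le _ _ _ (energy D s f) (q ^+ n) _ _)) => //.
  - by rewrite exprn_ge0// exprn_ge0// powR_ge0.
  - by move=> I; exact: energy_ge0.
  rewrite mulrC EFinM fineK ?total_fin//; apply: lee_wpmul2l.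
    by rewrite lee_fin exprn_ge0// exprn_ge0// powR_ge0.
  exact: esum_energy_generation.
apply: (@le_lt_trans _ _ (\esum_(I in S) (K%:E * F1 I +
  ((3 * M ^+ 2)%:E * (coeff_weight D s g I)%:E +
   (3 * N ^+ 2)%:E * (coeff_weight D s f I)%:E)))%E).
  apply: le_esum => I SI; rewrite /F1 -!EFinM -!EFinD lee_fin.
  exact: coeff_weight_product (SD _ SI).
have cM : 0 <= 3 * M ^+ 2 by rewrite mulr_ge0// exprn_ge0.
have cN : 0 <= 3 * N ^+ 2 by rewrite mulr_ge0// exprn_ge0.
rewrite !esumD; last first.
- by move=> I _; rewrite adde_ge0// mule_ge0.
- by move=> I _; rewrite mule_ge0.
- by move=> I _; rewrite mule_ge0.
- by move=> I _; rewrite mule_ge0.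
rewrite !lte_add_pinfty//; (apply: le_lt_trans (esumZl_le _ _ _) _ => //);
  rewrite lte_mul_pinfty//.
- exact: le_lt_trans (esum_subset _ SD) gE.
- exact: le_lt_trans (esum_subset _ SD) fE.
Qed.

Lemma dyadic_sobolev_mul f g : dyadic_sobolev D s f -> dyadic_sobolev D s g ->
  dyadic_sobolev D s (fun x => f x * g x).
Proof.
move=> sf sg; have [f2 fE] := sf; have [g2 gE] := sg.
have [M M0 fM] := sobolev_ae_bounded hD s_gt sf.
split; first exact: Lfun2_mul_bounded fM.
have w_ge0 h (I : set R) : (0 <= (coeff_weight D s h I)%:E)%E.
  by rewrite lee_fin coeff_weight_ge0.
rewrite (esumID (\bigcup_(n : nat) generation D (- n%:Z))); last first.
  by move=> I _; exact: (w_ge0 (fun x => f x * g x)).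
apply: lte_add_pinfty.
  by apply: le_lt_trans (esum_small sf sg); apply: esum_subset; exact: subIsetr.
have fg1 : mu.-integrable setT (EFin \o (fun x => f x * g x)).
  exact/Lfun1_integrable/Lfun2_mul_Lfun1.
have s0 : 0 <= s by have := s_gt; lra.
apply: le_lt_trans (esum_large hD s0 fg1); apply: esum_subset.
move=> I [DI nsmall]; have [k GI] := grid_generation hD DI.
case: k GI => [[|n]|n] GI.
- by exfalso; apply: nsmall; exists 0%N.
- by exists n.
- by exfalso; apply: nsmall; exists n.+1.
Qed.

End Product.

Theorem proposition13 (R : realType) (D : set (set R)) (hD : dyadic_grid D)
    (s : R) (hs : 1 / 2 < s < 1) :
  closed_under_product (dyadic_sobolev D s) /\
  (forall f : R -> R, dyadic_sobolev D s f ->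
     dyadic_sobolev D s (fun x => f x ^+ 2)).
Proof.
have /andP[s_gt _] := hs.
have mulS : closed_under_product (dyadic_sobolev D s).
  by move=> f g; exact: dyadic_sobolev_mul.
by split=> // f Sf; exact: mulS.
Qed.
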